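(* For all positive integers $s_1,s_2$ there exist positive constants $C_1,C_2,C_3,C_4$, depending only on $s_1$ and $s_2$, such that the following holds. Let $h^{(1)},h^{(2)},\theta>0$, let $\mathcal{X}\subset(-\pi,\pi]$ form an $(h^{(1)},s_1)$-cluster and let $\mathcal{Y}\subset(-\pi,\pi]$ form an $(h^{(2)},s_2)$-cluster, such that $\Delta(x,y)\ge\theta$ for all $x\in\mathcal{X}$ and $y\in\mathcal{Y}$. Put $h=\max(h^{(1)},h^{(2)})$. Then for all integers $N$ with $C_1\le N\le \frac{C_2}{h}$ we have $$\angle_{\min}\bigl(L(\mathcal{X},N),L(\mathcal{Y},N)\bigr)\ \ge\ \frac{\pi}{2}-\frac{C_4}{N\theta}-C_3Nh.$$
   Context: Wrap-around distance: for $x,y\in\mathbb{R}$, $\Delta(x,y)=|\operatorname{Arg}(e^{\imath(x-y)})|\in[0,\pi]$, where $\operatorname{Arg}$ is the principal argument with values in $(-\pi,\pi]$. Cluster: a set of $s$ distinct nodes $\mathcal{X}=\{x_1,\dots,x_s\}\subset(-\pi,\pi]$ forms an $(h,s)$-cluster if $0<\Delta(x,y)\le h$ for all $x,y\in\mathcal{X}$, $x\ne y$. Cluster subspace: for $\mathcal{X}=\{x_1,\dots,x_s\}\subset(-\pi,\pi]$ and $N\ge s-1$, $\mathbf{V}_N(\mathcal{X})$ is the $(N+1)\times s$ Vandermonde matrix with entries $e^{\imath k x_j}$ ($k=0,\dots,N$, $j=1,\dots,s$), and $L(\mathcal{X},N)\subset\mathbb{C}^{N+1}$ is the span of its columns.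 Minimal principal angle: for subspaces $L_1,L_2\subset\mathbb{C}^{N+1}$, $$\angle_{\min}(L_1,L_2)=\min_{v\in L_1\setminus\{0\},\,u\in L_2\setminus\{0\}}\arccos\left(\frac{|\langle v,u\rangle|}{\|v\|\,\|u\|}\right)\in\left[0,\tfrac{\pi}{2}\right].$$ *)

(* Defs.v *)
From HB Require Import structures.
From mathcomp Require Import all_boot all_order all_algebra.
From mathcomp Require Import all_classical all_reals all_analysis.
From mathcomp Require Import complex.

Set Implicit Arguments.
Unset Strict Implicit.
Unset Printing Implicit Defensive.

Import Order.TTheory GRing.Theory Num.Theory.

Local Open Scope classical_set_scope.
Local Open Scope ring_scope.

(* The complex number e^{it}, for a real t. *)
Definition expi (R : realType) (t : R) : R[i] := Complex (cos t) (sin t).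

(* Principal argument; the value at 0 is arbitrary. *)
Definition Arg (R : realType) (z : R[i]) : R :=
  xget 0 [set t : R | - pi < t <= pi /\
                      z = (Normc.normc z)%:C%C * expi t].

Definition wrap_dist (R : realType) (x y : R) : R := `|Arg (expi (x - y))|.

(* The nodes are given by an enumeration x_1, ..., x_s without repetition; the
   column span below does not depend on the order. *)
Definition is_cluster (R : realType) (h : R) (s : nat) (x : 'I_s -> R) : Prop :=
  [/\ injective x,
      forall i, - pi < x i <= pi
    & forall i j, x i != x j -> 0 < wrap_dist (x i) (x j) <= h].

Definition vandermonde_mx (R : realType) (s : nat) (x : 'I_s -> R) (N : nat) :
    'M[R[i]]_(N.+1, s) :=
  \matrix_(k < N.+1, j < s) expi (k%:R * x j).

Definition cluster_space (R : realType) (s : nat) (x : 'I_s -> R) (N : nat) :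
    {vspace 'cV[R[i]]_N.+1} :=
  <<[seq col j (vandermonde_mx x N) | j <- enum 'I_s]>>%VS.

(* Standard Hermitian inner product <v, u> = sum_k v_k (u_k)^*; dotmx is the
   library's version on row vectors. *)
Definition inner (R : realType) (n : nat) (v u : 'cV[R[i]]_n) : R[i] :=
  dotmx v^T u^T.

Definition l2norm (R : realType) (n : nat) (v : 'cV[R[i]]_n) : R :=
  Num.sqrt (complex.Re (inner v v)).

(* The infimum is a minimum as soon as L1 and L2 are nonzero (the unit spheres
   of L1 and L2 are compact). *)
Definition angle_min (R : realType) (n : nat)
    (L1 L2 : {vspace 'cV[R[i]]_n}) : R :=
  inf [set a : R | exists v u : 'cV[R[i]]_n,
    [/\ v \in L1, v != 0, u \in L2, u != 0
      & a = acos (Normc.normc (inner v u) / (l2norm v * l2norm u))]].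

(* Main.v *)
Require Import Defs.
From mathcomp Require Import all_boot all_order all_algebra.
From mathcomp Require Import all_classical all_reals all_analysis.
From mathcomp Require Import complex zify ring lra.

(** Up to a unimodular phase e^{i k x_1}, the coordinates of a vector of
    L(X, N) form an exponential sum f(k) = sum_j a_j z_j^k whose roots
    z_j = e^{i (x_j - x_1)} are within h of 1. Such a sum spreads its mass,
    max |f| <= C ||f|| / sqrt N, and varies slowly, |f(k+1) - f(k)| <= (C / N) max |f|
    once N h <= 1/4. The inner product of two vectors is therefore
    sum_k w^k F(k) with w = e^{i (x_1 - y_1)} and F = f * conj g slowly varying, and
    summation by parts bounds it by C ||v|| ||u|| / (N |w - 1|), where |w - 1| is
    comparable to the wrap-around distance. This yields the stronger bound without
    the N h term; that term is simply discarded (C3 = 1). *)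

Set Implicit Arguments.
Unset Strict Implicit.
Unset Printing Implicit Defensive.

Import Order.TTheory GRing.Theory Num.Theory.
Import numFieldNormedType.Exports.

Local Open Scope ring_scope.

(** * Exponential sums and Turan's inequality *)

Section ExponentialSums.
Variable R : rcfType.
Implicit Types (a z : nat -> R[i]) (f F : nat -> R[i]) (A : R).

Local Notation nm := (@Normc.normc R).

Lemma normc_ge0 (x : R[i]) : 0 <= nm x.
Proof. by case: x => u v; exact: sqrtr_ge0. Qed.

Lemma normcD_le (x y : R[i]) : nm (x + y) <= nm x + nm y.
Proof. exact: le_normcD. Qed.

Lemma normcN_eq (x : R[i]) : nm (- x) = nm x.
Proof. exact: normcN. Qed.

Lemma normcB_le (x y : R[i]) : nm (x - y) <= nm x + nm y.
Proof. by rewrite -[nm y]normcN_eq normcD_le. Qed.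

Lemma normcX (x : R[i]) n : nm (x ^+ n) = nm x ^+ n.
Proof.
elim: n => [|n IHn]; first by rewrite !expr0 Normc.normc1.
by rewrite !exprS Normc.normcM IHn.
Qed.

Lemma normc_sum_le (I : Type) (r : seq I) (P : pred I) (G : I -> R[i]) :
  nm (\sum_(i <- r | P i) G i) <= \sum_(i <- r | P i) nm (G i).
Proof.
elim/big_ind2: _ => //; first by rewrite Normc.normc0.
by move=> x b y d xb yd; apply: le_trans (normcD_le _ _) (lerD xb yd).
Qed.

Lemma sqr_normcB_le (x y : R[i]) :
  nm (x - y) ^+ 2 <= 2 * nm x ^+ 2 + 2 * nm y ^+ 2.
Proof.
apply: le_trans (_ : (nm x + nm y) ^+ 2 <= _).
  by rewrite lerXn2r ?nnegrE ?addr_ge0 ?normc_ge0 ?normcB_le.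
by have := sqr_ge0 (nm x - nm y); nra.
Qed.

(** Coefficients and roots are sequences over [nat], so that induction on [s] can keep the same [z]
    without casts between ordinals. *)
Definition expsum s a z (k : nat) : R[i] := \sum_(j < s) a j * z j ^+ k.

(** Subtracting [z s] times the previous value annihilates the term with root [z s]. This removal of
    one root drives both inductions on [s] below. *)
Lemma expsumS_diff s a z k :
  expsum s.+1 a z k.+1 - z s * expsum s.+1 a z k =
  expsum s (fun j => a j * (z j - z s)) z k.
Proof.
rewrite /expsum mulr_sumr -sumrB big_ord_recr /=.
rewrite exprS mulrCA subrr addr0.
by apply: eq_bigr => j _; rewrite exprS; ring.
Qed.

(** Sampling along an arithmetic progression gives an exponential sum again, with roots [z j ^+ m]
    that are unimodular whenever the [z j] are. *)
Lemma expsum_shift s a z k m n :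
  expsum s a z (k + m * n) =
  expsum s (fun j => a j * z j ^+ k) (fun j => z j ^+ m) n.
Proof. by apply: eq_bigr => j _; rewrite exprD exprM mulrA. Qed.

Lemma expsum_rev s a z N n : (forall j, (j < s)%N -> nm (z j) = 1) ->
  (n <= N)%N ->
  expsum s a z (N - n) =
  expsum s (fun j => a j * z j ^+ N) (fun j => (z j)^-1) n.
Proof.
move=> z1 nN; apply: eq_bigr => j _; rewrite -mulrA; congr (_ * _).
have zj0 : z j \is a GRing.unit.
  rewrite unitfE; apply/eqP => zj0; have := z1 j (ltn_ord j).
  by rewrite zj0 Normc.normc0 => /eqP; rewrite eq_sym oner_eq0.
by rewrite exprB // exprVn.
Qed.

(* Turan's first main theorem, in mean square: since the roots have modulus 1,
   the recurrence satisfied by an exponential sum can be run backwards without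
   loss. *)
Lemma expsum_turan s a z : (forall j, (j < s)%N -> nm (z j) = 1) ->
  nm (expsum s a z 0) ^+ 2 <=
  10 ^+ s * \sum_(1 <= i < s.+1) nm (expsum s a z i) ^+ 2.
Proof.
elim: s a z => [|s IHs] a z z1.
  by rewrite big_geq // /expsum big_ord0 Normc.normc0 expr0n mulr0.
set f := expsum s.+1 a z.
set g := expsum s (fun j => a j * (z j - z s)) z.
have gE k : g k = f k.+1 - z s * f k by rewrite expsumS_diff.
have zs1 : nm (z s) = 1 by apply: z1.
have nm_zsf k : nm (z s * f k) = nm (f k) by rewrite Normc.normcM zs1 mul1r.
have f0_le : nm (f 0) ^+ 2 <= 2 * nm (f 1) ^+ 2 + 2 * nm (g 0) ^+ 2.
  have -> : nm (f 0) = nm (f 1 - g 0) by rewrite gE opprB addrCA subrr addr0.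
  exact: sqr_normcB_le.
have g0_le := IHs _ _ (fun j js => z1 j (ltnW js)) : nm (g 0) ^+ 2 <= _.
set S := \sum_(1 <= i < s.+2) nm (f i) ^+ 2.
have S_first : S = nm (f 1) ^+ 2 + \sum_(1 <= i < s.+1) nm (f i.+1) ^+ 2.
  by rewrite /S big_nat_recl.
have S_last : S = \sum_(1 <= i < s.+1) nm (f i) ^+ 2 + nm (f s.+1) ^+ 2.
  by rewrite /S big_nat_recr.
have sum_g_le : \sum_(1 <= i < s.+1) nm (g i) ^+ 2 <= 4 * S.
  apply: (@le_trans _ _ (\sum_(1 <= i < s.+1)
     (2 * nm (f i.+1) ^+ 2 + 2 * nm (f i) ^+ 2))).
    by apply: ler_sum => i _; rewrite gE -(nm_zsf i) sqr_normcB_le.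
  rewrite big_split /= -!mulr_sumr.
  have := sqr_ge0 (nm (f 1)); have := sqr_ge0 (nm (f s.+1)).
  by lra.
have sum_f_ge0 : 0 <= \sum_(1 <= i < s.+1) nm (f i.+1) ^+ 2.
  by apply: sumr_ge0 => i _; exact: sqr_ge0.
have c1 : 1 <= 10 ^+ s :> R by rewrite exprn_ege1 // ler1n.
have S_ge0 : 0 <= S by apply: sumr_ge0 => i _; exact: sqr_ge0.
have g0_le' : nm (g 0) ^+ 2 <= 10 ^+ s * (4 * S).
  by apply: le_trans g0_le _; rewrite ler_wpM2l // (le_trans ler01).
have S_le : S <= 10 ^+ s * S by rewrite ler_peMl.
(* The constant 10 comes from 2 S + 2 (4 S 10^s) <= 10^(s+1) S. *)
by rewrite (exprS 10 s) -mulrA; lra.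
Qed.

(** * Nikolskii's inequality: pointwise bounds from mean squares *)

Lemma sum_image_le (m n : nat) (h : 'I_m -> 'I_n) (G : nat -> R) :
  injective h -> (forall k, 0 <= G k) ->
  \sum_(i < m) G (h i) <= \sum_(k < n) G k.
Proof.
move=> h_inj G0.
have := big_imset (fun k : 'I_n => G k) (in2W h_inj : {in predT &, injective h}).
move=> /= <-; rewrite [leRHS](bigID (mem [set h x | x in predT])) /=.
by rewrite lerDl; apply: sumr_ge0.
Qed.

(** Turan's inequality is applied along the progressions k + m, ..., k + s m for each m from 1 to M
    = N / (2 s), and the results are added. For fixed i the points k + m i are distinct and at most
    N, because k and s M are at most N / 2; so each i contributes at most the full sum [S]. *)
Lemma expsum_nikolskii_half s a z (N k : nat) : (0 < s)%N ->
  (forall j, (j < s)%N -> nm (z j) = 1) ->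
  (2 * s <= N)%N -> (2 * k <= N)%N ->
  N%:R * nm (expsum s a z k) ^+ 2 <=
  4 * s%:R ^+ 2 * 10 ^+ s * \sum_(n < N.+1) nm (expsum s a z n) ^+ 2.
Proof.
move=> s0 z1 sN kN; set f := expsum s a z; set S := \sum_(n < N.+1) _.
pose M := (N %/ (2 * s))%N.
have MN : (2 * s * M <= N)%N by rewrite mulnC leq_divM.
(* As 2 s <= N forces M >= 1, rounding down costs at most a factor 2. *)
have NM : (N <= 4 * s * M)%N.
  have := ltn_ceil N (_ : 0 < 2 * s)%N; rewrite muln_gt0 s0 => /(_ isT).
  have : (0 < M)%N by rewrite divn_gt0 ?muln_gt0 ?s0.
  by rewrite -/M; nia.
have step (m : nat) : nm (f k) ^+ 2 <=
    10 ^+ s * \sum_(1 <= i < s.+1) nm (f (k + m * i)) ^+ 2.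
  have := @expsum_turan s (fun j => a j * z j ^+ k) (fun j => z j ^+ m).
  rewrite -expsum_shift muln0 addn0.
  under eq_bigr do rewrite -expsum_shift.
  by apply => j js; rewrite normcX z1 // expr1n.
have sum_step : M%:R * nm (f k) ^+ 2 <= 10 ^+ s * (s%:R * S).
  have -> : M%:R * nm (f k) ^+ 2 = \sum_(m < M) nm (f k) ^+ 2.
    by rewrite sumr_const card_ord mulr_natl.
  apply: le_trans (ler_sum _ (fun (m : 'I_M) _ => step m.+1)) _.
  rewrite -mulr_sumr ler_wpM2l ?exprn_ge0 // exchange_big /=.
  rewrite [s%:R * S](_ : _ = \sum_(1 <= i < s.+1) S); last first.
    by rewrite sumr_const_nat subn1 mulr_natl.
  rewrite !big_nat; apply: ler_sum => i /andP[i0 si].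
  have bound (m : 'I_M) : (k + m.+1 * i < N.+1)%N by have := ltn_ord m; nia.
  apply: (@sum_image_le _ _ (fun m => Ordinal (bound m))
                        (fun n => nm (f n) ^+ 2)).
    move=> m m' [] /eqP; rewrite eqn_add2l eqn_pmul2r // eqSS => /eqP.
    exact: val_inj.
  by move=> n; exact: sqr_ge0.
have NMr : N%:R <= 4 * s%:R * M%:R :> R by rewrite -!natrM ler_nat.
have s0r : 0 <= s%:R :> R by [].
have f0 := sqr_ge0 (nm (f k)).
apply: (le_trans (ler_wpM2r f0 NMr)).
by have := ler_wpM2l (mulr_ge0 (ler0n R 4) s0r) sum_step; lra.
Qed.

(** Beyond the middle, the sum is read backwards from [N]: this moves [k] to [N - k], inverts the
    roots and preserves the total mass. *)
Lemma expsum_nikolskii s a z (N k : nat) : (0 < s)%N ->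
  (forall j, (j < s)%N -> nm (z j) = 1) ->
  (2 * s <= N)%N -> (k <= N)%N ->
  N%:R * nm (expsum s a z k) ^+ 2 <=
  4 * s%:R ^+ 2 * 10 ^+ s * \sum_(n < N.+1) nm (expsum s a z n) ^+ 2.
Proof.
move=> s0 z1 sN kN.
have [kN2|kN2] := leqP (2 * k) N; first exact: expsum_nikolskii_half.
have zV1 j : (j < s)%N -> nm (z j)^-1 = 1.
  by move=> js; rewrite Normc.normcV z1 // invr1.
have kN2' : (2 * (N - k) <= N)%N by lia.
have := expsum_nikolskii_half (fun j => a j * z j ^+ N) s0 zV1 sN kN2'.
rewrite -expsum_rev ?leq_subr // subKn // => /le_trans; apply.
rewrite [in leRHS](reindex_inj rev_ord_inj) /=.
rewrite [in leRHS](eq_bigr (fun n : 'I_N.+1 =>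
  nm (expsum s (fun j => a j * z j ^+ N) (fun j => (z j)^-1) n) ^+ 2)) // => n _.
by rewrite subSS expsum_rev // -ltnS.
Qed.

(** * Increments of exponential sums and summation by parts *)

Lemma increment_le F (L n k l : nat) (D : R) :
  (forall i, (i < L)%N -> nm (F i.+1 - F i) <= D) -> 0 <= D ->
  (k <= L)%N -> (l <= L)%N -> (k <= l + n)%N -> (l <= k + n)%N ->
  nm (F l - F k) <= n%:R * D.
Proof.
move=> FD D0.
have up (i p : nat) : (i + p <= L)%N -> nm (F (i + p)%N - F i) <= p%:R * D.
  elim: p => [|p IHp] ipL; first by rewrite addn0 subrr Normc.normc0 mul0r.
  have -> : F (i + p.+1)%N - F i =
            (F (i + p).+1 - F (i + p)%N) + (F (i + p)%N - F i).
    by rewrite addnS; ring.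
  apply: le_trans (normcD_le _ _) _; rewrite -natr1 mulrDl mul1r [leRHS]addrC.
  by apply: lerD; [apply: FD|apply: IHp]; lia.
have mono (p : nat) : (p <= n)%N -> p%:R * D <= n%:R * D.
  by move=> pn; rewrite ler_wpM2r // ler_nat.
move=> kL lL kln lkn; have [kl|/ltnW lk] := leqP k l.
  have := up k (l - k)%N; rewrite subnKC // => /(_ lL) /le_trans; apply.
  by apply: mono; lia.
rewrite -normcN_eq opprB.
have := up l (k - l)%N; rewrite subnKC // => /(_ kL) /le_trans; apply.
by apply: mono; lia.
Qed.

(* Bernstein's inequality: with the root [z s] divided out, the sum [g] moves
   slowly by induction, so it stays near its maximum over a positive proportion
   of the range; summing it there gives an increment of [f], which is bounded. *)
Lemma expsum_bernstein s a z (L : nat) A : (0 < L)%N ->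
  (forall j, (j < s)%N -> nm (z j - 1) * L%:R <= 4^-1) ->
  (forall k, (k <= L)%N -> nm (expsum s a z k) <= A) ->
  forall k, (k < L)%N ->
  nm (expsum s a z k.+1 - expsum s a z k) <= 33 ^+ s * A / L%:R.
Proof.
elim: s a z L A => [|s IHs] a z L A L0 zL fA.
  have A0 : 0 <= A by apply: le_trans (normc_ge0 _) (fA 0%N (leq0n _)).
  by move=> k _; rewrite /expsum !big_ord0 subrr Normc.normc0 expr0 mul1r divr_ge0.
move fE : (expsum s.+1 a z) fA => f fA.
pose g := expsum s (fun j => a j * (z j - z s)) z.
have A0 : 0 <= A by apply: le_trans (normc_ge0 _) (fA 0%N (leq0n _)).
have fg k : f k.+1 - f k = g k + (z s - 1) * f k.
  by rewrite /g -expsumS_diff fE; ring.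
have Lr0 : 0 < L%:R :> R by rewrite ltr0n.
have zs_le k : (k <= L)%N -> nm ((z s - 1) * f k) * L%:R <= 4^-1 * A.
  move=> kL; rewrite Normc.normcM mulrAC.
  by apply: ler_pM; rewrite ?mulr_ge0 ?normc_ge0 ?zL ?fA.
have c1 : 1 <= 33 ^+ s :> R by rewrite exprn_ege1 // ler1n.
have cA : A <= 33 ^+ s * A by rewrite ler_peMl.
(* The remaining part (z_s - 1) f(k) costs only A / (4 L), and 24 + 1/4 <= 33. *)
suff gA k : (k < L)%N -> nm (g k) * L%:R <= 24 * (33 ^+ s * A).
  move=> k kL; rewrite ler_pdivlMr // (exprS 33 s) -mulrA fg.
  have := ler_wpM2r (ltW Lr0) (normcD_le (g k) ((z s - 1) * f k)).
  by have := gA k kL; have := zs_le k (ltnW kL); rewrite mulrDl; lra.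
(* A value of [g] uses two consecutive values of [f], so the induction hypothesis applies on a range
   shorter by one; length 1 is treated directly. *)
case: L L0 Lr0 zL fA zs_le => // -[|L] _ Lr0 zL fA zs_le.
  case: k => // _; rewrite mulr1.
  have -> : g 0%N = (f 1%N - f 0%N) - (z s - 1) * f 0%N by rewrite fg addrK.
  have := normcB_le (f 1%N - f 0%N) ((z s - 1) * f 0%N).
  have := normcB_le (f 1%N) (f 0%N).
  have := fA 0%N isT; have := fA 1%N isT; have := zs_le 0%N isT; rewrite mulr1.
  lra.
pose k0 := [arg max_(i > (ord0 : 'I_L.+2)) nm (g i)]%O.
have gmax i : (i < L.+2)%N -> nm (g i) <= nm (g k0).
  rewrite /k0; case: arg_maxP => //= j _ jmax iL.
  exact: (jmax (Ordinal iL)).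
move: (ltn_ord k0) gmax; move: (nat_of_ord k0) => {}k0 k0L gmax kL.
apply: le_trans (ler_wpM2r (ltW Lr0) (gmax k kL)) _.
set G := nm (g k0).
have G0 : 0 <= G by exact: normc_ge0.
have gD : forall i, (i < L.+1)%N -> nm (g i.+1 - g i) <= 33 ^+ s * G / L.+1%:R.
  apply: IHs => // j js; apply: le_trans (zL j (ltnW js)).
  by rewrite ler_wpM2l ?normc_ge0 // ler_nat.
pose C := (33 ^ s)%N.
have CE : C%:R = 33 ^+ s :> R by rewrite natrX.
have C0 : (0 < C)%N by rewrite expn_gt0.
(* A window of [m] indices has m - 1 steps, over which [g] moves by at most (m - 1) 33^s G / (L + 1)
   <= G / 2. *)
pose m := (L.+1 %/ (2 * C)).+1.
have m_lb : (L.+1 < m * (2 * C))%N by rewrite ltn_ceil // muln_gt0.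
have m_ub : (m.-1 * (2 * C) <= L.+1)%N by rewrite leq_divM.
have m0 : (0 < m)%N by [].
have mL : (m <= L.+2)%N by nia.
(* The window starting at [b] contains [k0] and is pushed left where needed, so that b + m <= L +
   2. *)
pose b := minn k0 (L.+2 - m).
have near_max (l : nat) : (l < m)%N -> nm (g (b + l)%N - g k0) <= G / 2.
  move=> lm; apply: le_trans (increment_le (n := m.-1) gD _ _ _ _ _) _.
  - by rewrite divr_ge0 ?mulr_ge0 // (le_trans ler01).
  - by lia.
  - by rewrite /b; lia.
  - by rewrite /b; lia.
  - by rewrite /b; lia.
  rewrite mulrA ler_pdivrMr ?ltr0n // -CE mulrA.
  have : m.-1%:R * (2 * C%:R) <= L.+1%:R :> R by rewrite -!natrM ler_nat.
  by move=> /(ler_wpM2r G0); lra.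
have tele (n : nat) : f (b + n)%N - f b =
    \sum_(l < n) (g (b + l)%N + (z s - 1) * f (b + l)%N).
  elim: n => [|n IHn]; first by rewrite big_ord0 addn0 subrr.
  by rewrite big_ord_recr /= -IHn -fg addnS; ring.
(* On the window, m g(k0) is the increment f(b + m) - f(b), of size at most 2 A, minus the
   deviations of [g] from g(k0) and the terms in z_s - 1. *)
have mG : m%:R * G <= 2 * A + m%:R * (G / 2) + m%:R * (A / 4 / L.+2%:R).
  have -> : m%:R * G = nm (m%:R * g k0).
    by rewrite (mulr_natl (g k0)) normcMn mulr_natl.
  have -> : m%:R * g k0 = (f (b + m)%N - f b) -
     \sum_(l < m) ((g (b + l)%N - g k0) + (z s - 1) * f (b + l)%N).
    rewrite tele -sumrB (eq_bigr (fun=> g k0)); last by move=> l _; ring.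
    by rewrite sumr_const card_ord mulr_natl.
  apply: le_trans (normcB_le _ _) _; rewrite -addrA; apply: lerD.
    apply: le_trans (normcB_le _ _) _.
    have := fA (b + m)%N; have := fA b; rewrite /b => f1 f2.
    by have := f1 ltac:(lia); have := f2 ltac:(lia); lra.
  apply: le_trans (normc_sum_le _ _ _) _.
  rewrite -mulrDr mulr_natl -[X in _ *+ X]card_ord -sumr_const.
  apply: ler_sum => l _; apply: le_trans (normcD_le _ _) _.
  apply: lerD; first exact: near_max.
  rewrite ler_pdivlMr // [leRHS]mulrC; apply: zs_le.
  by rewrite /b; have := ltn_ord l; lia.
have mLA : m%:R * (A / 4 / L.+2%:R) <= A / 4.
  have mLr : m%:R <= L.+2%:R :> R by rewrite ler_nat.
  by rewrite mulrA ler_pdivrMr // [leLHS]mulrC ler_wpM2l // divr_ge0.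
have LCm : L.+2%:R <= 4 * C%:R * m%:R :> R by rewrite -!natrM ler_nat; nia.
have mGA : m%:R * G <= 9 / 2 * A.
  by move: mG mLA; move: (m%:R * (A / 4 / _)) => X; lra.
(* Altogether G (L + 2) <= 4 C m G <= 18 C A, within the required 24 C A. *)
have := ler_wpM2l G0 LCm.
have := ler_wpM2l (ler0n R (4 * C)) mGA; rewrite natrM CE.
lra.
Qed.

(** Multiplication by w - 1 turns w^k into the difference w^(k+1) - w^k. Summation by parts moves
    this difference onto [F], and the two boundary terms cost 2 B. *)
Lemma oscillating_sum_le (w : R[i]) F (N : nat) (B D : R) : nm w = 1 ->
  (forall k, (k <= N)%N -> nm (F k) <= B) ->
  (forall k, (k < N)%N -> nm (F k.+1 - F k) <= D) ->
  nm (w - 1) * nm (\sum_(k < N.+1) w ^+ k * F k) <= 2 * B + N%:R * D.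
Proof.
move=> w1 FB FD.
have parts : (w - 1) * (\sum_(k < N.+1) w ^+ k * F k) =
    w ^+ N.+1 * F N - F 0%N - \sum_(k < N) w ^+ k.+1 * (F k.+1 - F k).
  elim: (N) => [|n IHn]; first by rewrite big_ord1 big_ord0 !expr0 expr1; ring.
  by rewrite big_ord_recr /= mulrDr IHn [in RHS]big_ord_recr /= !exprS; ring.
rewrite -Normc.normcM parts.
apply: le_trans (normcB_le _ _) _; apply: lerD.
  apply: le_trans (normcB_le _ _) _.
  rewrite Normc.normcM normcX w1 expr1n mul1r.
  by have := FB N (leqnn N); have := FB 0%N (leq0n N); lra.
apply: le_trans (normc_sum_le _ _ _) _.
rewrite mulr_natl -[X in D *+ X]card_ord -sumr_const; apply: ler_sum => k _.
by rewrite Normc.normcM normcX w1 expr1n mul1r FD.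
Qed.

End ExponentialSums.

(** * Trigonometric estimates and the wrap-around distance *)

Section WrapAround.
Variable R : realType.
Implicit Types c s t x y : R.

Local Notation nm := (@Normc.normc R).

Lemma sin_le_id t : 0 <= t -> sin t <= t.
Proof.
move=> t0; have [c _] : exists2 c, c \in `[0, t] & sin t - sin 0 = cos c * (t - 0).
  apply: MVT_segment => //.
  exact/continuous_subspaceT/continuous_sin.
rewrite sin0 !subr0 => ->; have := cos_le1 c.
by move: (cos c) => k; nra.
Qed.

Lemma normr_sin_le t : `|sin t| <= `|t|.
Proof.
wlog t0 : t / 0 <= t => [Ht|].
  have [/Ht//|/ltW t0] := leP 0 t.
  by rewrite -(normrN (sin t)) -sinN -(normrN t) Ht // oppr_ge0.
rewrite (ger0_norm t0) ler_norml sin_le_id // andbT.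
have [t1|/ltW t1] := leP t 1; last by apply: le_trans (sin_geN1 t); rewrite lerN2.
apply: (@le_trans _ _ 0); first by rewrite oppr_le0.
by apply: sin_ge0_pi; rewrite t0 (le_trans t1) // (le_trans _ (pi_ge2 R)) // ler1n.
Qed.

Lemma cos_half_angle t : cos t = 1 - 2 * sin (t / 2) ^+ 2.
Proof.
rewrite sin2cos2 -[in LHS](divfK (_ : 2 != 0 :> R) t) ?pnatr_eq0 //.
by rewrite mulr_natr cos_mulr2n; ring.
Qed.

Lemma cos_ge_quadratic t : 1 - t ^+ 2 / 2 <= cos t.
Proof.
rewrite cos_half_angle.
have : `|sin (t / 2)| ^+ 2 <= `|t / 2| ^+ 2.
  by rewrite lerXn2r ?nnegrE ?normr_ge0 ?normr_sin_le.
by rewrite !real_normK ?num_real // expr_div_n; lra.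
Qed.

(** A crude Jordan inequality. On [0, 1] the mean value theorem applies with cos >= 1/2; on
    [1, pi/2] monotonicity gives sin t >= sin 1 >= 1/2, while t < 2. *)
Lemma sin_ge_linear t : 0 <= t <= pi / 2 -> t <= 4 * sin t.
Proof.
move=> /andP[t0 tpi].
have le1 s : 0 <= s <= 1 -> s <= 2 * sin s.
  move=> /andP[s0 s1].
  have [c cs] : exists2 c, c \in `[0, s] & sin s - sin 0 = cos c * (s - 0).
    apply: MVT_segment => //.
    exact/continuous_subspaceT/continuous_sin.
  rewrite sin0 !subr0 => ->; move: cs; rewrite in_itv /= => /andP[c0 cs].
  have := cos_ge_quadratic c; have : c ^+ 2 <= 1 by rewrite expr_le1 // (le_trans cs).
  by move: (cos c) => k; nra.
have [t1|/ltW t1] := leP t 1.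
  by have := le1 t; rewrite t0 t1 => /(_ isT); lra.
have pi2 := pihalf_ge1 R; have pi3 := pihalf_lt2 R.
have : sin 1 <= sin t.
  rewrite leNgt ltr_sin ?in_itv /= -?leNgt //; apply/andP; split; lra.
by have := le1 1; rewrite ler01 lexx => /(_ isT); lra.
Qed.

(** The complementary angle pi/2 - acos c has sine c, so the linear bound on the sine applies to
    it. *)
Lemma acos_ge_linear c : 0 <= c <= 1 -> pi / 2 - 4 * c <= acos c.
Proof.
move=> /andP[c0 c1]; have cB : -1 <= c <= 1 by rewrite c1 (le_trans _ c0) // lerN10.
have [/andP[a0 _] ca] := acos_def cB.
have [ap|/ltW ap] := leP (acos c) (pi / 2); last lra.
have := @sin_ge_linear (pi / 2 - acos c).
rewrite -[sin _]opprK -sinN opprB sinBpihalf opprK ca; lra.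
Qed.

Lemma expiD s t : expi (s + t) = expi s * expi t :> R[i].
Proof.
rewrite /expi cosD sinD; apply/eqP; rewrite eq_complex /=.
by rewrite eqxx /= addrC.
Qed.

Lemma expi0 : expi (0 : R) = 1.
Proof. by rewrite /expi cos0 sin0. Qed.

Lemma expi_natmul (n : nat) t : expi (n%:R * t) = expi t ^+ n.
Proof.
elim: n => [|n IHn]; first by rewrite mul0r expi0.
by rewrite -natr1 mulrDl mul1r addrC expiD IHn exprS.
Qed.

Lemma conj_expi t : (expi t)^*%C = expi (- t).
Proof. by rewrite /expi cosN sinN. Qed.

Lemma normc_expi t : nm (expi t) = 1.
Proof. by rewrite /= cos2Dsin2 sqrtr1. Qed.

Lemma normc_expi_sub1 t : nm (expi t - 1) = 2 * `|sin (t / 2)|.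
Proof.
rewrite -[2 * _]ger0_norm ?mulr_ge0 // -sqrtr_sqr /=; congr Num.sqrt.
rewrite oppr0 addr0 exprMn real_normK ?num_real // (sin2cos2 t).
by rewrite cos_half_angle; ring.
Qed.

Lemma wrap_distP x y : - pi < x <= pi -> - pi < y <= pi ->
  exists a : R, [/\ expi (x - y) = expi a, `|a| <= pi & wrap_dist x y = `|a|].
Proof.
move=> /andP[x1 x2] /andP[y1 y2]; have pi0 := pi_gt0 R.
pose S := [set t : R | - pi < t <= pi /\
  expi (x - y) = (nm (expi (x - y)))%:C%C * expi t]%classic.
(* The default 0 of [xget] is ruled out by a witness: x - y lies in (-2 pi, 2 pi), so at most one
   shift by 2 pi brings it into (-pi, pi]. *)
have : S (xget 0 S).
  apply: xgetPex; rewrite /S /= cos2Dsin2 sqrtr1.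
  have e2 t : expi (t + pi *+ 2) = expi t by rewrite /expi cosD2pi sinD2pi.
  have [d1|d1] := leP (x - y) (- pi).
    exists (x - y + pi *+ 2); rewrite e2 mul1r; split=> //.
    by rewrite -mulr_natl; lra.
  have [d2|d2] := leP (x - y) pi.
    by exists (x - y); rewrite mul1r; split=> //; rewrite d1 d2.
  exists (x - y - pi *+ 2); rewrite -[in RHS]e2 subrK mul1r; split=> //.
  by rewrite -mulr_natl; lra.
move=> [/andP[a1 a2]]; rewrite normc_expi mul1r => aE; exists (xget 0 S).
by split=> //; rewrite ler_norml a2 ltW.
Qed.

Lemma normc_expi_sub1_le x y : - pi < x <= pi -> - pi < y <= pi ->
  nm (expi (x - y) - 1) <= wrap_dist x y.
Proof.
move=> xB yB; have [a [-> _ ->]] := wrap_distP xB yB.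
rewrite normc_expi_sub1; have := normr_sin_le (a / 2).
by rewrite normrM (ger0_norm (_ : 0 <= 2^-1)) ?invr_ge0 //; lra.
Qed.

(** Half the arc lies in [0, pi/2], where the sine is at least a quarter of its argument. This
    converts the separation [theta] into a lower bound on |w - 1|. *)
Lemma wrap_dist_le x y : - pi < x <= pi -> - pi < y <= pi ->
  wrap_dist x y <= 4 * nm (expi (x - y) - 1).
Proof.
move=> xB yB; have [a [-> ap ->]] := wrap_distP xB yB.
have : `|a| / 2 <= 4 * sin (`|a| / 2).
  by apply: sin_ge_linear; rewrite divr_ge0 //= ler_pM2r ?invr_gt0.
rewrite normc_expi_sub1.
have -> : `|sin (a / 2)| = `|sin (`|a| / 2)|.
  by have [a0|a0] := ger0P a; rewrite // mulNr sinN normrN.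
by have := ler_norm (sin (`|a| / 2)); lra.
Qed.

End WrapAround.

(** * Inner products between two cluster spaces *)

Section ClusterSpaces.
Variable R : realType.

Local Notation nm := (@Normc.normc R).

Lemma innerE n (v u : 'cV[R[i]]_n) :
  inner v u = \sum_(k < n) v k 0 * (u k 0)^*%C.
Proof.
by rewrite /inner dotmxE !mxE; apply: eq_bigr => k _; rewrite !mxE.
Qed.

Lemma normcJ_eq (x : R[i]) : nm x^*%C = nm x.
Proof. by case: x => p q; rewrite /= sqrrN. Qed.

Lemma Re_inner_self n (v : 'cV[R[i]]_n) :
  complex.Re (inner v v) = \sum_(k < n) nm (v k 0) ^+ 2.
Proof.
rewrite innerE raddf_sum; apply: eq_bigr => k _.
case: (v k 0) => p q /=; rewrite sqr_sqrtr ?addr_ge0 ?sqr_ge0 //.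
by rewrite mulrN opprK -!expr2.
Qed.

Lemma l2norm_sqr n (v : 'cV[R[i]]_n) :
  l2norm v ^+ 2 = \sum_(k < n) nm (v k 0) ^+ 2.
Proof.
rewrite /l2norm Re_inner_self sqr_sqrtr //.
by apply: sumr_ge0 => k _; exact: sqr_ge0.
Qed.

Lemma l2norm_ge0 n (v : 'cV[R[i]]_n) : 0 <= l2norm v.
Proof. exact: sqrtr_ge0. Qed.

Lemma l2norm_gt0 n (v : 'cV[R[i]]_n) : v != 0 -> 0 < l2norm v.
Proof.
move=> v0; rewrite lt_neqAle l2norm_ge0 andbT eq_sym.
apply: contra v0 => /eqP nv0; apply/eqP/colP => k; rewrite mxE.
apply: Normc.eq0_normc; apply/eqP; rewrite -sqrf_eq0.
have := l2norm_sqr v; rewrite nv0 expr0n => /esym/eqP.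
rewrite psumr_eq0 => [/allP/(_ k)|j _]; last exact: sqr_ge0.
by rewrite mem_index_enum => /(_ isT).
Qed.

Lemma inner_le n (v u : 'cV[R[i]]_n) : nm (inner v u) <= l2norm v * l2norm u.
Proof.
have [CS _] := CauchySchwarz (@dotmx R[i] n) v^T u^T.
have real_inner (w : 'cV[R[i]]_n) : inner w w = (l2norm w ^+ 2)%:C%C.
  rewrite l2norm_sqr innerE rmorph_sum /=; apply: eq_bigr => k _.
  by rewrite -sqr_normc rmorphXn.
rewrite -(@ler_pXn2r _ 2) ?nnegrE ?mulr_ge0 ?normc_ge0 ?l2norm_ge0 //.
rewrite -lecR exprMn.
have -> : (nm (inner v u) ^+ 2)%:C%C = `|inner v u| ^+ 2 by rewrite [LHS]rmorphXn.
have -> : (l2norm v ^+ 2 * l2norm u ^+ 2)%:C%C = inner v v * inner u u.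
  by rewrite [LHS]rmorphM !real_inner.
exact: CS.
Qed.

(** Factoring out the phase of the first node recentres the roots near 1, as Bernstein's inequality
    requires. *)
Lemma cluster_spaceP s (x : 'I_s.+1 -> R) N (v : 'cV[R[i]]_N.+1) :
  v \in cluster_space x N ->
  exists a : nat -> R[i], forall k : 'I_N.+1, v k 0 = expi (x ord0) ^+ k *
    expsum s.+1 a (fun j => expi (x (inord j) - x ord0)) k.
Proof.
set X := map_tuple (fun j => col j (vandermonde_mx x N)) (ord_tuple s.+1).
rewrite /cluster_space -[[seq _ | j <- _]]/(tval X) => /coord_span ->.
exists (fun j => coord X (inord j) v) => k.
rewrite summxE /expsum mulr_sumr; apply: eq_bigr => j _.
rewrite !mxE inord_val.
have -> : X`_j = col j (vandermonde_mx x N).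
  by rewrite -(tnth_nth 0 X j) tnth_map tnth_ord_tuple.
rewrite !mxE expi_natmul mulrCA -exprMn -expiD.
by rewrite addrC subrK.
Qed.

(** Nikolskii's inequality after a square root, with 10^(s/2) rounded up to 10^s. *)
Lemma expsum_sup_le s a z N A k : (0 < s)%N -> (2 * s <= N)%N -> 0 <= A ->
  (forall j, (j < s)%N -> nm (z j) = 1) ->
  \sum_(n < N.+1) nm (expsum s a z n) ^+ 2 = A ^+ 2 -> (k <= N)%N ->
  nm (expsum s a z k) <= 2 * s%:R * 10 ^+ s * A / Num.sqrt N%:R.
Proof.
move=> s0 sN A0 z1 AE kN.
have N0 : 0 < N%:R :> R by rewrite ltr0n; lia.
have c1 : 1 <= 10 ^+ s :> R by rewrite exprn_ege1 // ler1n.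
have c0 := le_trans ler01 c1.
rewrite ler_pdivlMr ?sqrtr_gt0 //.
rewrite -(@ler_pXn2r _ 2) ?nnegrE ?mulr_ge0 ?normc_ge0 ?sqrtr_ge0 //.
rewrite exprMn sqr_sqrtr ?(ltW N0) // mulrC.
apply: le_trans (expsum_nikolskii a s0 z1 sN kN) _.
rewrite AE [leRHS]exprMn ler_wpM2r ?sqr_ge0 //.
rewrite [leRHS](_ : _ = 4 * s%:R ^+ 2 * 10 ^+ s * 10 ^+ s); last by ring.
by rewrite ler_peMr // !mulr_ge0 ?exprn_ge0.
Qed.

Lemma cluster_spaces_inner_le s1 s2 (x : 'I_s1.+1 -> R) (y : 'I_s2.+1 -> R)
    (h theta : R) N (v u : 'cV[R[i]]_N.+1) :
  is_cluster h x -> is_cluster h y ->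
  theta <= wrap_dist (x ord0) (y ord0) -> 0 < h -> N%:R * h <= 4^-1 ->
  (2 * s1.+1 <= N)%N -> (2 * s2.+1 <= N)%N ->
  v \in cluster_space x N -> u \in cluster_space y N ->
  theta * (N%:R * nm (inner v u)) <=
  4 * (2 + 33 ^+ s1.+1 + 33 ^+ s2.+1) * (2 * s1.+1%:R * 10 ^+ s1.+1)
    * (2 * s2.+1%:R * 10 ^+ s2.+1) * (l2norm v * l2norm u).
Proof.
move=> [_ xB xh] [_ yB yh] thxy h0 Nh s1N s2N.
move=> /cluster_spaceP[a vE] /cluster_spaceP[b uE].
move: vE uE; set p := fun j => expi (x (inord j) - x ord0).
set q := fun j => expi (y (inord j) - y ord0).
set f := expsum _ a p; set g := expsum _ b q => vE uE.
have N0 : 0 < N%:R :> R by rewrite ltr0n; lia.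
have near1 s (w : 'I_s.+1 -> R) : (forall i, - pi < w i <= pi) ->
    (forall i j, w i != w j -> 0 < wrap_dist (w i) (w j) <= h) ->
    forall j : nat, nm (expi (w (inord j) - w ord0) - 1) * N%:R <= 4^-1.
  move=> wB wh j; apply: le_trans Nh; rewrite mulrC ler_wpM2l ?ler0n //.
  (* The cluster condition concerns distinct nodes only, so the first node itself is split off. *)
  have [->|wj] := eqVneq (w (inord j)) (w ord0).
    by rewrite subrr expi0 subrr Normc.normc0 ltW.
  apply: le_trans (normc_expi_sub1_le (wB _) (wB _)) _.
  by have /andP[] := wh _ _ wj.
have nmE s (w : 'I_s.+1 -> R) (c : nat -> R[i]) (vv : 'cV[R[i]]_N.+1) F :
    (forall k : 'I_N.+1, vv k 0 = expi (w ord0) ^+ k * F k) ->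
    \sum_(n < N.+1) nm (F n) ^+ 2 = l2norm vv ^+ 2.
  move=> vvE; rewrite l2norm_sqr; apply: eq_bigr => n _.
  by rewrite vvE Normc.normcM normcX normc_expi expr1n mul1r.
set K1 := 2 * s1.+1%:R * 10 ^+ s1.+1; set K2 := 2 * s2.+1%:R * 10 ^+ s2.+1.
pose A := K1 * l2norm v / Num.sqrt N%:R; pose B := K2 * l2norm u / Num.sqrt N%:R.
have fA k : (k <= N)%N -> nm (f k) <= A.
  apply: expsum_sup_le => // [|j _|]; rewrite ?l2norm_ge0 ?normc_expi //.
  exact: (nmE _ x a).
have gB k : (k <= N)%N -> nm (g k) <= B.
  apply: expsum_sup_le => // [|j _|]; rewrite ?l2norm_ge0 ?normc_expi //.
  exact: (nmE _ y b).
have NN : (0 < N)%N by lia.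
have fD := expsum_bernstein NN (fun j _ => near1 _ x xB xh j) fA.
have gD := expsum_bernstein NN (fun j _ => near1 _ y yB yh j) gB.
have A0 : 0 <= A by apply: le_trans (fA 0%N _); rewrite ?normc_ge0.
have B0 : 0 <= B by apply: le_trans (gB 0%N _); rewrite ?normc_ge0.
pose F k := f k * (g k)^*%C.
have innerF : inner v u = \sum_(k < N.+1) expi (x ord0 - y ord0) ^+ k * F k.
  rewrite innerE; apply: eq_bigr => k _; rewrite vE uE expiD -conj_expi.
  by rewrite exprMn rmorphM rmorphXn /= /F; ring.
have FB k : (k <= N)%N -> nm (F k) <= A * B.
  move=> kN; rewrite Normc.normcM normcJ_eq.
  by apply: ler_pM; rewrite ?normc_ge0 ?fA ?gB.
(* The discrete product rule combines the sup bounds and the Bernstein bounds of both factors. *)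
have FD k : (k < N)%N -> nm (F k.+1 - F k) <=
    (33 ^+ s1.+1 + 33 ^+ s2.+1) * (A * B) / N%:R.
  move=> kN.
  have -> : F k.+1 - F k =
      (f k.+1 - f k) * (g k.+1)^*%C + f k * (g k.+1 - g k)^*%C.
    by rewrite /F rmorphB /=; ring.
  apply: le_trans (normcD_le _ _) _; rewrite !Normc.normcM !normcJ_eq.
  rewrite [leRHS](_ : _ = (33 ^+ s1.+1 * A / N%:R) * B +
                          A * (33 ^+ s2.+1 * B / N%:R)); last by ring.
  apply: lerD; apply: ler_pM; try exact: normc_ge0.
  - exact: fD.
  - exact: gB.
  - exact: fA (ltnW kN).
  - exact: gD.
have wB := wrap_dist_le (xB ord0) (yB ord0).
have := oscillating_sum_le (normc_expi (x ord0 - y ord0)) FB FD.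
rewrite -innerF.
have -> : N%:R * ((33 ^+ s1.+1 + 33 ^+ s2.+1) * (A * B) / N%:R) =
  (33 ^+ s1.+1 + 33 ^+ s2.+1) * (A * B) by rewrite mulrCA mulfV ?gt_eqF ?mulr1.
(* The two factors 1 / sqrt N combine here into the decay 1 / N. *)
have -> : A * B = K1 * K2 * (l2norm v * l2norm u) / N%:R.
  by rewrite /A /B mulf_div -expr2 sqr_sqrtr ?(ltW N0) // mulrACA.
set X := K1 * K2 * _; set E := 33 ^+ _ + _; set I := nm (inner v u).
set W := nm (_ - 1) in wB * => WI.
have thW : theta * (N%:R * I) <= 4 * (N%:R * (W * I)).
  rewrite mulrCA (mulrCA 4) ler_wpM2l ?(ltW N0) // mulrA ler_wpM2r ?normc_ge0 //.
  exact: le_trans thxy wB.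
apply: le_trans thW _.
have := ler_wpM2l (ltW N0) WI.
have NX : N%:R * (X / N%:R) = X by rewrite mulrCA mulfV ?gt_eqF ?mulr1.
rewrite mulrDr !(mulrCA N%:R _ (X / _)) NX => bound.
rewrite [leRHS](_ : _ = 4 * (2 * X + E * X)) ?ler_wpM2l //.
by rewrite -mulrDl /X /E /K1 /K2 addrA !mulrA.
Qed.

Lemma cluster_space_neq0 s (x : 'I_s.+1 -> R) N :
  exists2 v, v \in cluster_space x N & v != 0.
Proof.
exists (col ord0 (vandermonde_mx x N)).
  by apply: memv_span; apply/mapP; exists ord0; rewrite ?mem_enum.
apply/eqP => /colP/(_ ord0); rewrite !mxE mul0r expi0 => /eqP.
by rewrite oner_eq0.
Qed.

End ClusterSpaces.

(** * Choice of constants and passage to the angle *)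

Theorem theorem2p1 (R : realType) (s1 s2 : nat) (hs1 : (0 < s1)%N)
    (hs2 : (0 < s2)%N) :
  exists C1 C2 C3 C4 : R,
    [/\ 0 < C1, 0 < C2, 0 < C3 & 0 < C4] /\
    forall (h1 h2 theta : R) (x : 'I_s1 -> R) (y : 'I_s2 -> R),
      0 < h1 -> 0 < h2 -> 0 < theta ->
      is_cluster h1 x -> is_cluster h2 y ->
      (forall i j, theta <= wrap_dist (x i) (y j)) ->
      forall N : nat,
        C1 <= N%:R <= C2 / Num.max h1 h2 ->
        angle_min (cluster_space x N) (cluster_space y N)
          >= pi / 2 - C4 / (N%:R * theta) - C3 * N%:R * Num.max h1 h2.
Proof.
case: s1 hs1 => // s1 _; case: s2 hs2 => // s2 _.
pose K : R := 4 * (2 + 33 ^+ s1.+1 + 33 ^+ s2.+1)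
  * (2 * s1.+1%:R * 10 ^+ s1.+1) * (2 * s2.+1%:R * 10 ^+ s2.+1).
have K0 : 0 < K by rewrite !mulr_gt0 ?addr_gt0 ?exprn_gt0 ?ltr0n.
(* C1 ensures 2 s_i <= N for Nikolskii, C2 ensures N h <= 1/4 for Bernstein, and the factor 4 in C4
   is the slope in [acos_ge_linear]. *)
exists (2 * (s1.+1 + s2.+1))%:R, 4^-1, 1, (4 * K).
split; first by rewrite ltr0n ltr01 invr_gt0 mulr_gt0.
move=> h1 h2 theta x y h1_gt0 h2_gt0 theta_gt0 xC yC xy N /andP[NC1 NC2].
set h := Num.max h1 h2.
have h_gt0 : 0 < h by rewrite lt_max h1_gt0.
have widen s (w : 'I_s -> R) h' : h' <= h -> is_cluster h' w -> is_cluster h w.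
  move=> h'h [w_inj wB wh]; split=> // i j /wh /andP[-> /le_trans]; exact.
have xC' : is_cluster h x by apply: widen xC; rewrite le_max lexx.
have yC' : is_cluster h y by apply: widen yC; rewrite le_max lexx orbT.
have Nh : N%:R * h <= 4^-1 by rewrite -ler_pdivlMr.
move: NC1; rewrite ler_nat => sN.
have [sN1 sN2] : (2 * s1.+1 <= N)%N /\ (2 * s2.+1 <= N)%N by lia.
have N_gt0 : 0 < N%:R :> R by rewrite ltr0n; lia.
(* A lower bound passes to [inf] only for a nonempty set, hence the nonzero vectors. *)
apply: lb_le_inf.
  have [v vL v0] := cluster_space_neq0 x N.
  have [u uL u0] := cluster_space_neq0 y N.
  by exists (acos (Normc.normc (inner v u) / (l2norm v * l2norm u))), v, u.
move=> _ [v [u [vL v0 uL u0 ->]]].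
have vu_gt0 : 0 < l2norm v * l2norm u by rewrite mulr_gt0 ?l2norm_gt0.
set c := _ / (l2norm v * _).
have c_le : c <= K / (N%:R * theta).
  rewrite /c ler_pdivrMr // mulrAC ler_pdivlMr ?mulr_gt0 //.
  rewrite (mulrC N%:R) mulrCA (mulrC _ N%:R).
  exact: cluster_spaces_inner_le xC' yC' (xy ord0 ord0) h_gt0 Nh sN1 sN2 vL uL.
have c01 : 0 <= c <= 1.
  rewrite divr_ge0 ?normc_ge0 ?(ltW vu_gt0) //=.
  by rewrite ler_pdivrMr // mul1r inner_le.
apply: le_trans (acos_ge_linear c01).
apply: (@le_trans _ _ (pi / 2 - 4 * K / (N%:R * theta))).
  by rewrite gerBl mul1r mulr_ge0 ?ler0n ?(ltW h_gt0).
by rewrite lerD2l lerN2 -(mulrA 4) ler_wpM2l.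
Qed.
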